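(* Let $t\ge 2$ and $N\ge (t+2)^2$. Let $\mathrm X_N=\{\bm x_1,\ldots,\bm x_N\}\subset\mathbb S^2$ be a stationary point set of $A_{N,t}$, and assume that the minimal singular value of the basis matrix $\mathbf Y_{t+1}(\mathrm X_N)\in\mathbb R^{(t+2)^2\times N}$ is positive, i.e. all $(t+2)^2$ singular values of $\mathbf Y_{t+1}(\mathrm X_N)$ are positive. Then $\mathrm X_N$ is a spherical $t$-design.
   Context: $\mathbb S^2=\{\bm x\in\mathbb R^3:\lVert \bm x\rVert_2=1\}$ with surface measure $d\omega$. $\Pi_t$ denotes the space of (restrictions to $\mathbb S^2$ of) polynomials on $\mathbb R^3$ of degree at most $t$. A finite set $\mathrm X_N=\{\bm x_1,\ldots,\bm x_N\}\subset\mathbb S^2$ is a spherical $t$-design if $\frac1N\sum_{i=1}^N p(\bm x_i)=\frac{1}{4\pi}\int_{\mathbb S^2}p\,d\omega$ for all $p\in\Pi_t$. Let $\{\mathrm Y_n^k: n=0,\ldots,t,\ k=1,\ldots,2n+1\}$ be a complete set of real spherical harmonics orthonormal in $L_2(\mathbb S^2)$ forming a basis of $\Pi_t$ ($\mathrm Y_n^k$ of degree $n$), with $\mathrm Y_0^1=1/\sqrt{4\pi}$. Define $$A_{N,t}(\mathrm X_N)=\frac{4\pi}{N^2}\sum_{n=1}^t\sum_{k=1}^{2n+1}\Big(\sum_{i=1}^N\mathrm Y_n^k(\bm x_i)\Big)^2=\frac{4\pi}{N^2}\sum_{j=1}^N\sum_{i=1}^N\sum_{n=1}^t\frac{2n+1}{4\pi}\mathrm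 P_n(\langle\bm x_j,\bm x_i\rangle),$$ where $\mathrm P_n$ is the Legendre polynomial of degree $n$, viewed as a function of $(\bm x_1,\ldots,\bm x_N)\in(\mathbb S^2)^N$. $\mathrm X_N$ is a stationary point set of $A_{N,t}$ if for each $i$ the spherical (surface) gradient of $A_{N,t}$ with respect to $\bm x_i\in\mathbb S^2$ (the other points held fixed) vanishes at $\mathrm X_N$. For a degree $s$, the basis matrix $\mathbf Y_s(\mathrm X_N)\in\mathbb R^{(s+1)^2\times N}$ has rows indexed by $(n,k)$, $0\le n\le s$, $1\le k\le 2n+1$, and columns indexed by $i=1,\ldots,N$, with entry $\mathrm Y_n^k(\bm x_i)$ (so the first row is $\frac{1}{\sqrt{4\pi}}(1,\ldots,1)$). *)

(* Defs.v *)
From Stdlib Require Import Reals Lra.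
Open Scope R_scope.

Record V3 := mkV3 { v1 : R; v2 : R; v3 : R }.

Definition dot (x y : V3) : R := v1 x * v1 y + v2 x * v2 y + v3 x * v3 y.
Definition vadd (x y : V3) : V3 := mkV3 (v1 x + v1 y) (v2 x + v2 y) (v3 x + v3 y).
Definition vscale (s : R) (x : V3) : V3 := mkV3 (s * v1 x) (s * v2 x) (s * v3 x).
Definition vsub (x y : V3) : V3 := vadd x (vscale (-1) y).
Definition vzero : V3 := mkV3 0 0 0.

Definition on_sphere (x : V3) : Prop := dot x x = 1.

Definition e_coord (c : nat) : V3 :=
  match c with 0%nat => mkV3 1 0 0 | 1%nat => mkV3 0 1 0 | _ => mkV3 0 0 1 end.
Definition coord (c : nat) (x : V3) : R :=
  match c with 0%nat => v1 x | 1%nat => v2 x | _ => v3 x end.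

Fixpoint sumn (n : nat) (f : nat -> R) : R :=
  match n with 0%nat => 0 | S k => sumn k f + f k end.

Definition is_poly (d : nat) (p : V3 -> R) : Prop :=
  exists c : nat -> nat -> nat -> R, forall v : V3,
    p v = sumn (S d) (fun a => sumn (S d) (fun b => sumn (S d) (fun e =>
            if Nat.leb (a + b + e) d
            then c a b e * v1 v ^ a * v2 v ^ b * v3 v ^ e else 0))).

(* Surface integral over S^2 (surface measure d omega), via spherical
   coordinates: int_0^{2 pi} int_0^pi p(sin th cos ph, sin th sin ph, cos th) sin th dth dph.
   sphere_integral p I means this iterated Riemann integral exists and equals I
   (RiemannInt does not depend on the integrability proofs). *)
Definition sph (th ph : R) : V3 := mkV3 (sin th * cos ph) (sin th * sin ph) (cos th).

Definition sphere_integral (p : V3 -> R) (I : R) : Prop :=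
  exists (pr : forall ph : R,
            Riemann_integrable (fun th => p (sph th ph) * sin th) 0 PI)
         (pr2 : Riemann_integrable (fun ph => RiemannInt (pr ph)) 0 (2 * PI)),
    RiemannInt pr2 = I.

(* Legendre polynomials: P_0 = 1, P_1 = x,
   (n+2) P_{n+2} = (2n+3) x P_{n+1} - (n+1) P_n.  leg2 n x = (P_n x, P_{n+1} x). *)
Fixpoint leg2 (n : nat) (x : R) : R * R :=
  match n with
  | 0%nat => (1, x)
  | S k => let (a, b) := leg2 k x in
           (b, ((2 * INR k + 3) * x * b - (INR k + 1) * a) / (INR k + 2))
  end.
Definition legendre (n : nat) (x : R) : R := fst (leg2 n x).

Definition A_Nt (N t : nat) (X : nat -> V3) : R :=
  4 * PI / (INR N * INR N) *
  sumn N (fun j => sumn N (fun i => sumn t (fun m =>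
     (2 * INR (S m) + 1) / (4 * PI) * legendre (S m) (dot (X j) (X i))))).

Definition upd (X : nat -> V3) (i : nat) (y : V3) : nat -> V3 :=
  fun k => if Nat.eqb k i then y else X k.

(* Stationary point set: for each i, the spherical gradient of A_{N,t} w.r.t. x_i,
   i.e. the tangential projection (I - x_i x_i^T) g of the Euclidean gradient g
   of A_{N,t} w.r.t. x_i, vanishes. *)
Definition stationary (N t : nat) (X : nat -> V3) : Prop :=
  forall i, (i < N)%nat ->
    exists g : V3,
      (forall c, (c < 3)%nat ->
         derivable_pt_lim
           (fun s => A_Nt N t (upd X i (vadd (X i) (vscale s (e_coord c))))) 0
           (coord c g)) /\
      vsub g (vscale (dot g (X i)) (X i)) = vzero.

Definition spherical_design (N t : nat) (X : nat -> V3) : Prop :=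
  forall p, is_poly t p ->
    exists I, sphere_integral p I /\
      / INR N * sumn N (fun i => p (X i)) = / (4 * PI) * I.

Definition orthonormal_basis (s : nat) (Y : nat -> V3 -> R) : Prop :=
  let M := ((s + 1) * (s + 1))%nat in
  (forall j, (j < M)%nat -> is_poly s (Y j)) /\
  (forall j k, (j < M)%nat -> (k < M)%nat ->
     sphere_integral (fun v => Y j v * Y k v) (if Nat.eqb j k then 1 else 0)) /\
  (forall p, is_poly s p -> exists a : nat -> R,
     forall v, on_sphere v -> p v = sumn M (fun j => a j * Y j v)).

(* Minimal singular value of the M x N matrix B (entries B j i, j < M, i < N),
   M <= N: sigma_min(B) = min_{||a||_2 = 1} ||B^T a||_2. *)
Definition min_singular_value (M N : nat) (B : nat -> nat -> R) (sigma : R) : Prop :=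
  (exists a : nat -> R, sumn M (fun j => a j ^ 2) = 1 /\
     sqrt (sumn N (fun i => (sumn M (fun j => a j * B j i)) ^ 2)) = sigma) /\
  (forall a : nat -> R, sumn M (fun j => a j ^ 2) = 1 ->
     sigma <= sqrt (sumn N (fun i => (sumn M (fun j => a j * B j i)) ^ 2))).

Definition basis_matrix (Y : nat -> V3 -> R) (X : nat -> V3) : nat -> nat -> R :=
  fun j i => Y j (X i).

(* Main.v *)
Require Import Defs.
From Stdlib Require Import Reals Lra Lia List FunctionalExtensionality.
From Coquelicot Require Import Coquelicot.
Open Scope R_scope.

(* Stationarity says that the tangent field grad f, with
   f(x) = sum_k sum_(1 <= n <= t) (2n+1)/(4 pi) P_n(x.x_k), vanishes at all sample
   points. Its components are polynomials of degree t+1 on the sphere, so by full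
   rank of the basis matrix it vanishes identically. Hence the Laplace-Beltrami
   operator kills f; as its eigenvalues -n(n+1) are distinct and nonzero,
   sum_k P_n(x.x_k) = 0 on the sphere for each 1 <= n <= t, and therefore
   sum_k (x.x_k)^m is constant on the sphere for m <= t.

   Instead of a reproducing kernel, both the sum over the points and the surface
   integral are identified through the moment recursion
   m(m+1) L(p) = L(Laplacian p), p a monomial of degree m, which determines L from
   L(1). For the points it comes from the ridge functions p(x) = (v.x)^m by
   differentiating in v; for the integral it is the Wallis recursion. *)

(** * Finite sums and polynomials *)

Lemma sumn_ext (n : nat) (f g : nat -> R) :
  (forall i, (i < n)%nat -> f i = g i) -> sumn n f = sumn n g.
Proof.
induction n as [|n IH]; intros H; simpl; [reflexivity|].
rewrite IH by (intros; apply H; lia). rewrite H by lia. reflexivity.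
Qed.

Lemma sumn_plus (n : nat) (f g : nat -> R) :
  sumn n (fun i => f i + g i) = sumn n f + sumn n g.
Proof. induction n as [|n IH]; simpl; [|rewrite IH]; ring. Qed.

Lemma sumn_scal (n : nat) (c : R) (f : nat -> R) :
  sumn n (fun i => c * f i) = c * sumn n f.
Proof. induction n as [|n IH]; simpl; [|rewrite IH]; ring. Qed.

Lemma sumn_zero (n : nat) : sumn n (fun _ => 0) = 0.
Proof. induction n as [|n IH]; simpl; [|rewrite IH]; ring. Qed.

Lemma sumn_one (n : nat) : sumn n (fun _ => 1) = INR n.
Proof. induction n as [|n IH]; [reflexivity|]. rewrite S_INR; simpl; rewrite IH; ring. Qed.

Lemma sumn_delta (n a : nat) (f : nat -> R) :
  (a < n)%nat -> sumn n (fun i => (if Nat.eqb i a then 1 else 0) * f i) = f a.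
Proof.
induction n as [|n IH]; intros H; [lia|]. simpl.
destruct (Nat.eq_dec a n) as [->|E].
- rewrite Nat.eqb_refl, (sumn_ext n _ (fun _ => 0)), sumn_zero; [ring|].
  intros i Hi. replace (Nat.eqb i n) with false; [ring|].
  symmetry; apply Nat.eqb_neq; lia.
- rewrite IH by lia. replace (Nat.eqb n a) with false; [ring|].
  symmetry; apply Nat.eqb_neq; lia.
Qed.

Lemma sumn_nonneg (n : nat) (f : nat -> R) :
  (forall i, 0 <= f i) -> 0 <= sumn n f.
Proof. intros H; induction n as [|n IH]; simpl; [lra|]. specialize (H n); lra. Qed.

Lemma sumn_sq_eq0 (n : nat) (a : nat -> R) :
  sumn n (fun j => a j ^ 2) = 0 -> forall j, (j < n)%nat -> a j = 0.
Proof.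
induction n as [|n IH]; intros H j Hj; [lia|]. simpl in H.
assert (0 <= sumn n (fun j => a j ^ 2))
  by (apply sumn_nonneg; intros; apply pow2_ge_0).
pose proof (pow2_ge_0 (a n)).
assert (E : a n ^ 2 = 0) by (simpl in *; lra).
destruct (Nat.eq_dec j n) as [->|Ne]; [nra|].
apply IH; [simpl in *; lra|lia].
Qed.

Lemma is_derive_sumn (n : nat) (f : nat -> R -> R) (d : nat -> R) (x : R) :
  (forall i, (i < n)%nat -> is_derive (f i) x (d i)) ->
  is_derive (fun s => sumn n (fun i => f i s)) x (sumn n d).
Proof.
induction n as [|n IH]; intros H; simpl.
- apply (is_derive_const 0 x).
- apply (is_derive_plus (fun s => sumn n (fun i => f i s)) (f n)).
  + apply IH; intros; apply H; lia.
  + apply H; lia.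
Qed.

(** Serves to differentiate identities that hold along a whole curve: an orbit of rotations, or a
    line in the parameter of a ridge function. *)
Lemma is_derive_const_eq0 (f : R -> R) (C x l : R) :
  (forall s, f s = C) -> is_derive f x l -> l = 0.
Proof.
intros H D. apply is_derive_unique in D. rewrite <- D.
rewrite (Derive_ext f (fun _ => C)) by assumption. apply Derive_const.
Qed.

Definition mono (a b c : nat) (v : V3) : R := v1 v ^ a * v2 v ^ b * v3 v ^ c.

Lemma is_poly_zero (d : nat) : is_poly d (fun _ => 0).
Proof.
exists (fun _ _ _ => 0); intros v; symmetry.
rewrite <- (sumn_zero (S d)) at 1; apply sumn_ext; intros a _.
rewrite <- (sumn_zero (S d)) at 1; apply sumn_ext; intros b _.
rewrite <- (sumn_zero (S d)) at 1; apply sumn_ext; intros e _.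
destruct (Nat.leb _ _); ring.
Qed.

Lemma is_poly_plus (d : nat) (p q : V3 -> R) :
  is_poly d p -> is_poly d q -> is_poly d (fun v => p v + q v).
Proof.
intros [c Hc] [c' Hc']; exists (fun a b e => c a b e + c' a b e); intros v.
rewrite Hc, Hc', <- sumn_plus; apply sumn_ext; intros a _.
rewrite <- sumn_plus; apply sumn_ext; intros b _.
rewrite <- sumn_plus; apply sumn_ext; intros e _.
destruct (Nat.leb _ _); ring.
Qed.

Lemma is_poly_scal (d : nat) (r : R) (p : V3 -> R) :
  is_poly d p -> is_poly d (fun v => r * p v).
Proof.
intros [c Hc]; exists (fun a b e => r * c a b e); intros v.
rewrite Hc, <- sumn_scal; apply sumn_ext; intros a _.
rewrite <- sumn_scal; apply sumn_ext; intros b _.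
rewrite <- sumn_scal; apply sumn_ext; intros e _.
destruct (Nat.leb _ _); ring.
Qed.

Lemma is_poly_mono (d a b e : nat) :
  (a + b + e <= d)%nat -> is_poly d (mono a b e).
Proof.
intros H.
set (delta := fun i j : nat => if Nat.eqb i j then 1 else 0).
exists (fun a' b' e' => delta a' a * (delta b' b * delta e' e)); intros v.
transitivity (sumn (S d) (fun a' => delta a' a *
  sumn (S d) (fun b' => delta b' b *
  sumn (S d) (fun e' => delta e' e *
    (if Nat.leb (a' + b' + e') d then mono a' b' e' v else 0))))).
- unfold delta. rewrite sumn_delta by lia. rewrite sumn_delta by lia.
  rewrite sumn_delta by lia.
  replace (Nat.leb (a + b + e) d) with true; [reflexivity|].
  symmetry; apply Nat.leb_le; lia.
- apply sumn_ext; intros a' _.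
  rewrite <- sumn_scal; apply sumn_ext; intros b' _.
  rewrite <- !sumn_scal; apply sumn_ext; intros e' _.
  unfold mono; destruct (Nat.leb _ _); ring.
Qed.

(** Polynomials are spanned by monomials, so a property stable under sums need only be checked on
    scaled monomials. *)
Lemma is_poly_elim (d : nat) (Q : (V3 -> R) -> Prop) :
  Q (fun _ => 0) ->
  (forall p q, Q p -> Q q -> Q (fun v => p v + q v)) ->
  (forall r a b e, (a + b + e <= d)%nat -> Q (fun v => r * mono a b e v)) ->
  forall p, is_poly d p -> Q p.
Proof.
intros Q0 Qp Qm p [c Hc].
assert (Qs : forall n (f : nat -> V3 -> R),
  (forall i, Q (f i)) -> Q (fun v => sumn n (fun i => f i v))).
{ intros n f Hf; induction n as [|n IH]; simpl; auto. }
replace p with (fun v => sumn (S d) (fun a => sumn (S d) (fun b => sumn (S d) (fun e =>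
            if Nat.leb (a + b + e) d
            then c a b e * v1 v ^ a * v2 v ^ b * v3 v ^ e else 0))))
  by (extensionality v; symmetry; apply Hc).
apply (Qs (S d) (fun a v => sumn (S d) (fun b => sumn (S d) (fun e =>
            if Nat.leb (a + b + e) d
            then c a b e * v1 v ^ a * v2 v ^ b * v3 v ^ e else 0)))); intros a.
apply (Qs (S d) (fun b v => sumn (S d) (fun e =>
            if Nat.leb (a + b + e) d
            then c a b e * v1 v ^ a * v2 v ^ b * v3 v ^ e else 0))); intros b.
apply (Qs (S d) (fun e v => if Nat.leb (a + b + e) d
            then c a b e * v1 v ^ a * v2 v ^ b * v3 v ^ e else 0)); intros e.
destruct (Nat.leb (a + b + e) d) eqn:L; [|exact Q0].
apply Nat.leb_le in L.
replace (fun v => _) with (fun v => c a b e * mono a b e v)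
  by (extensionality v; unfold mono; ring).
auto.
Qed.

Lemma is_poly_le (d d' : nat) (p : V3 -> R) :
  (d <= d')%nat -> is_poly d p -> is_poly d' p.
Proof.
intros H; apply (is_poly_elim d (is_poly d')).
- apply is_poly_zero.
- apply is_poly_plus.
- intros; apply is_poly_scal, is_poly_mono; lia.
Qed.

Lemma is_poly_const (d : nat) (r : R) : is_poly d (fun _ => r).
Proof.
replace (fun _ : V3 => r) with (fun v => r * mono 0 0 0 v)
  by (extensionality v; unfold mono; simpl; ring).
apply is_poly_scal, is_poly_mono; lia.
Qed.

Lemma is_poly_coord (d c : nat) (p : V3 -> R) :
  is_poly d p -> is_poly (S d) (fun v => coord c v * p v).
Proof.
apply (is_poly_elim d (fun p => is_poly (S d) (fun v => coord c v * p v))).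
- replace (fun v => coord c v * 0) with (fun _ : V3 => 0)
    by (extensionality v; ring).
  apply is_poly_zero.
- intros q r Hq Hr.
  replace (fun v => coord c v * (q v + r v))
    with (fun v => coord c v * q v + coord c v * r v) by (extensionality v; ring).
  now apply is_poly_plus.
- intros r a b e H.
  replace (fun v => coord c v * (r * mono a b e v)) with
    (fun v => r * match c with
      | 0%nat => mono (S a) b e v | 1%nat => mono a (S b) e v | _ => mono a b (S e) v end)
    by (extensionality v; destruct c as [|[|]]; unfold mono; simpl; ring).
  apply is_poly_scal; destruct c as [|[|]]; apply is_poly_mono; lia.
Qed.

Lemma is_poly_dot (d : nat) (w : V3) (p : V3 -> R) :
  is_poly d p -> is_poly (S d) (fun v => dot v w * p v).
Proof.
intros H.
replace (fun v => dot v w * p v) with (fun v => v1 w * (coord 0 v * p v) +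
  (v2 w * (coord 1 v * p v) + v3 w * (coord 2 v * p v)))
  by (extensionality v; unfold dot; simpl; ring).
repeat apply is_poly_plus; apply is_poly_scal, is_poly_coord, H.
Qed.

Lemma is_poly_sumn (d n : nat) (f : nat -> V3 -> R) :
  (forall i, (i < n)%nat -> is_poly d (f i)) ->
  is_poly d (fun v => sumn n (fun i => f i v)).
Proof.
induction n as [|n IH]; intros H; simpl; [apply is_poly_zero|].
apply is_poly_plus; [apply IH; intros; apply H; lia|apply H; lia].
Qed.

(** * Legendre polynomials *)

Lemma legendre_SS (n : nat) (x : R) :
  (INR n + 2) * legendre (S (S n)) x =
  (2 * INR n + 3) * x * legendre (S n) x - (INR n + 1) * legendre n x.
Proof.
unfold legendre; simpl leg2. destruct (leg2 n x) as [a b]. cbn [fst].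
pose proof (pos_INR n). field; lra.
Qed.

(** The classical identity P_{n+1}' = x P_n' + (n+1) P_n, taken as a definition;
    [is_derive_legendre] shows that it gives the derivative. [ddlegendre] is this recursion
    differentiated once more. *)
Fixpoint dlegendre (n : nat) (x : R) : R :=
  match n with
  | 0%nat => 0
  | S k => x * dlegendre k x + (INR k + 1) * legendre k x
  end.

Fixpoint ddlegendre (n : nat) (x : R) : R :=
  match n with
  | 0%nat => 0
  | S k => x * ddlegendre k x + (INR k + 2) * dlegendre k x
  end.

Lemma dlegendre_rec (n : nat) (x : R) :
  (x * x - 1) * dlegendre n x = (INR n + 1) * (legendre (S n) x - x * legendre n x).
Proof.
induction n as [|n IH]; [unfold legendre; simpl; ring|].
pose proof (legendre_SS n x).
rewrite S_INR; cbn [dlegendre].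
transitivity (x * ((x * x - 1) * dlegendre n x) +
  (x * x - 1) * (INR n + 1) * legendre n x); [ring|].
rewrite IH.
replace ((INR n + 1 + 1) * (legendre (S (S n)) x - x * legendre (S n) x)) with
  ((INR n + 2) * legendre (S (S n)) x - (INR n + 2) * x * legendre (S n) x) by ring.
rewrite H; ring.
Qed.

Lemma is_derive_legendre (n : nat) (x : R) :
  is_derive (legendre n) x (dlegendre n x).
Proof.
enough (is_derive (legendre n) x (dlegendre n x) /\
        is_derive (legendre (S n)) x (dlegendre (S n) x)) by tauto.
induction n as [|n [IH1 IH2]].
- split; simpl.
  + apply (is_derive_ext (fun _ => 1)); [reflexivity|]. apply (is_derive_const 1 x).
  + apply (is_derive_ext (fun s => s)); [reflexivity|].
    replace (x * 0 + (0 + 1) * legendre 0 x) with 1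
      by (unfold legendre; simpl; ring).
    apply (is_derive_id x).
- split; [exact IH2|].
  pose proof (pos_INR n) as Hn.
  apply (is_derive_ext (fun s => / (INR n + 2) *
    ((2 * INR n + 3) * (s * legendre (S n) s) - (INR n + 1) * legendre n s))).
  { intros s. apply (Rmult_eq_reg_l (INR n + 2)); [|lra].
    rewrite legendre_SS. field; lra. }
  assert (D : is_derive (fun s => / (INR n + 2) *
    ((2 * INR n + 3) * (s * legendre (S n) s) - (INR n + 1) * legendre n s)) x
    (/ (INR n + 2) * ((2 * INR n + 3) *
       (1 * legendre (S n) x + x * dlegendre (S n) x) - (INR n + 1) * dlegendre n x))).
  { apply is_derive_scal.
    apply (is_derive_minus (fun s => (2 * INR n + 3) * (s * legendre (S n) s))
      (fun s => (INR n + 1) * legendre n s)).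
    - apply is_derive_scal.
      apply (is_derive_mult (fun s => s) (legendre (S n)));
        [apply (is_derive_id x)|exact IH2|intros; apply Rmult_comm].
    - apply is_derive_scal, IH1. }
  replace (dlegendre (S (S n)) x) with (/ (INR n + 2) * ((2 * INR n + 3) *
       (1 * legendre (S n) x + x * dlegendre (S n) x) - (INR n + 1) * dlegendre n x));
    [exact D|].
  pose proof (dlegendre_rec n x) as H.
  (* Inserting the definition of P_{n+1}' into [dlegendre_rec] gives this backward recursion. It
     removes P_n' from the differentiated three-term recursion, leaving only terms of degree n+1. *)
  assert (E : dlegendre n x = x * dlegendre (S n) x - (INR n + 1) * legendre (S n) x).
  { cbn [dlegendre]. lra. }
  rewrite E.
  change (dlegendre (S (S n)) x) with
    (x * dlegendre (S n) x + (INR (S n) + 1) * legendre (S n) x).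
  rewrite S_INR. field; lra.
Qed.

Lemma is_derive_dlegendre (n : nat) (x : R) :
  is_derive (dlegendre n) x (ddlegendre n x).
Proof.
induction n as [|n IH]; [apply (is_derive_const 0 x)|].
apply (is_derive_ext (fun s => s * dlegendre n s + (INR n + 1) * legendre n s));
  [reflexivity|].
replace (ddlegendre (S n) x) with
  ((1 * dlegendre n x + x * ddlegendre n x) + (INR n + 1) * dlegendre n x)
  by (cbn [ddlegendre]; ring).
apply (is_derive_plus (fun s => s * dlegendre n s) (fun s => (INR n + 1) * legendre n s)).
- apply (is_derive_mult (fun s => s) (dlegendre n));
    [apply (is_derive_id x)|exact IH|intros; apply Rmult_comm].
- apply is_derive_scal, is_derive_legendre.
Qed.

(** Legendre's equation, by induction: unfolding the recursions in degree n+1 leaves x times the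
    equation in degree n, a multiple of [dlegendre_rec], and terms in x P_n that cancel. *)
Lemma legendre_ode (n : nat) (x : R) :
  (1 - x * x) * ddlegendre n x - 2 * x * dlegendre n x =
  - (INR n * (INR n + 1)) * legendre n x.
Proof.
induction n as [|n IH]; [simpl; ring|].
pose proof (dlegendre_rec n x) as H.
rewrite S_INR; cbn [ddlegendre dlegendre].
transitivity (x * ((1 - x * x) * ddlegendre n x - 2 * x * dlegendre n x)
  - (INR n + 2) * ((x * x - 1) * dlegendre n x) - 2 * x * (INR n + 1) * legendre n x);
  [ring|].
rewrite IH, H; ring.
Qed.

Lemma is_poly_legendre (n : nat) (w : V3) :
  is_poly n (fun v => legendre n (dot v w)).
Proof.
enough (is_poly n (fun v => legendre n (dot v w)) /\
        is_poly (S n) (fun v => legendre (S n) (dot v w))) by tauto.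
induction n as [|n [IH1 IH2]].
- split; [apply (is_poly_const 0 1)|].
  replace (fun v => legendre 1 (dot v w)) with (fun v => dot v w * 1)
    by (extensionality v; unfold legendre; simpl; ring).
  apply is_poly_dot, is_poly_const.
- split; [exact IH2|].
  replace (fun v => legendre (S (S n)) (dot v w)) with (fun v =>
    ((2 * INR n + 3) / (INR n + 2)) * (dot v w * legendre (S n) (dot v w)) +
    (- (INR n + 1) / (INR n + 2)) * legendre n (dot v w)).
  + apply is_poly_plus; apply is_poly_scal;
      [now apply is_poly_dot|now apply (is_poly_le n); [lia|]].
  + extensionality v. pose proof (pos_INR n) as Hn.
    apply (Rmult_eq_reg_l (INR n + 2)); [|lra].
    rewrite legendre_SS. field; lra.
Qed.

(** The drop in degree matters: it keeps the tangent field within degree t+1. *)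
Lemma is_poly_dlegendre (n : nat) (w : V3) :
  is_poly n (fun v => dlegendre (S n) (dot v w)).
Proof.
induction n as [|n IH].
- replace (fun v => dlegendre 1 (dot v w)) with (fun _ : V3 => 1)
    by (extensionality v; cbn [dlegendre]; unfold legendre; simpl; ring).
  apply is_poly_const.
- replace (fun v => dlegendre (S (S n)) (dot v w)) with (fun v =>
    dot v w * dlegendre (S n) (dot v w) +
    (INR (S n) + 1) * legendre (S n) (dot v w)) by reflexivity.
  apply is_poly_plus; [now apply is_poly_dot|apply is_poly_scal, is_poly_legendre].
Qed.

(** * Zonal sums and the Laplace-Beltrami operator *)

(** Rotation by the angle s about the coordinate axis c. Derivatives along these orbits stay on the
    sphere and so stand in for the surface gradient. *)
Definition rot (c : nat) (s : R) (x : V3) : V3 :=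
  match c with
  | 0%nat => mkV3 (v1 x) (cos s * v2 x - sin s * v3 x) (sin s * v2 x + cos s * v3 x)
  | 1%nat => mkV3 (cos s * v1 x + sin s * v3 x) (v2 x) (cos s * v3 x - sin s * v1 x)
  | _ => mkV3 (cos s * v1 x - sin s * v2 x) (sin s * v1 x + cos s * v2 x) (v3 x)
  end.

(** The velocity at s = 0 of the rotation about axis c, that is, the cross product of [e_coord c]
    with x. *)
Definition spin (c : nat) (x : V3) : V3 :=
  match c with
  | 0%nat => mkV3 0 (- v3 x) (v2 x)
  | 1%nat => mkV3 (v3 x) 0 (- v1 x)
  | _ => mkV3 (- v2 x) (v1 x) 0
  end.

Lemma rot_0 (c : nat) (x : V3) : rot c 0 x = x.
Proof.
destruct x as [a b d], c as [|[|]]; unfold rot; simpl; rewrite sin_0, cos_0;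
  f_equal; ring.
Qed.

Lemma rot_on_sphere (c : nat) (s : R) (x : V3) : on_sphere x -> on_sphere (rot c s x).
Proof.
unfold on_sphere; intros <-. pose proof (sin2_cos2 s) as H; unfold Rsqr in H.
destruct x as [a b d], c as [|[|]]; unfold dot, rot; simpl.
- transitivity (a * a + (sin s * sin s + cos s * cos s) * (b * b + d * d));
    [ring|rewrite H; ring].
- transitivity (b * b + (sin s * sin s + cos s * cos s) * (a * a + d * d));
    [ring|rewrite H; ring].
- transitivity (d * d + (sin s * sin s + cos s * cos s) * (a * a + b * b));
    [ring|rewrite H; ring].
Qed.

Lemma spin_rot (c : nat) (s : R) (x : V3) : spin c (rot c s x) = rot c s (spin c x).
Proof. destruct x as [a b d], c as [|[|]]; unfold rot, spin; simpl; f_equal; ring. Qed.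

Lemma is_derive_dot_rot (c : nat) (x y : V3) :
  is_derive (fun s => dot (rot c s x) y) 0 (dot (spin c x) y).
Proof.
destruct x as [a b d], y as [a' b' d'], c as [|[|]]; unfold dot, rot, spin; simpl;
  auto_derive; trivial; rewrite sin_0, cos_0; ring.
Qed.

Lemma is_derive_zonal (q q' : R -> R) (c : nat) (x y : V3) :
  (forall u, is_derive q u (q' u)) ->
  is_derive (fun s => q (dot (rot c s x) y)) 0 (dot (spin c x) y * q' (dot x y)).
Proof.
intros H. apply (is_derive_comp q (fun s => dot (rot c s x) y)).
- rewrite rot_0; apply H.
- apply is_derive_dot_rot.
Qed.

(* Summing the squares of the three infinitesimal rotations gives the
   Laplace-Beltrami operator, which acts on functions [q (dot x y)] of [x]
   as the Legendre operator [(1 - u^2) q'' - 2 u q'] in [u = dot x y]. *)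
Lemma sum_beltrami_eq0_of_tangent (N : nat) (X : nat -> V3) (q q' : R -> R) :
  (forall k, (k < N)%nat -> on_sphere (X k)) ->
  (forall u, is_derive q u (q' u)) ->
  (forall c x, on_sphere x ->
     sumn N (fun k => dot (spin c x) (X k) * q (dot x (X k))) = 0) ->
  forall x, on_sphere x ->
    sumn N (fun k => (1 - dot x (X k) * dot x (X k)) * q' (dot x (X k))
                     - 2 * dot x (X k) * q (dot x (X k))) = 0.
Proof.
intros HX Hq HE x Hx.
(* The derivative of the k-th term of the hypothesis along the rotation about axis c. *)
pose (F := fun c k => dot (spin c (spin c x)) (X k) * q (dot x (X k)) +
  dot (spin c x) (X k) * (dot (spin c x) (X k) * q' (dot x (X k)))).
assert (H : forall c, sumn N (F c) = 0).
{ intros c.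
  apply (is_derive_const_eq0 (fun s => sumn N (fun k =>
    dot (spin c (rot c s x)) (X k) * q (dot (rot c s x) (X k)))) 0 0).
  - intros s; apply HE, rot_on_sphere, Hx.
  - apply (is_derive_sumn N (fun k s =>
      dot (spin c (rot c s x)) (X k) * q (dot (rot c s x) (X k)))); intros k _.
    pose proof (is_derive_mult (fun s => dot (spin c (rot c s x)) (X k))
      (fun s => q (dot (rot c s x) (X k))) 0 (dot (spin c (spin c x)) (X k))
      (dot (spin c x) (X k) * q' (dot x (X k)))) as D.
    cbv beta in D; rewrite !rot_0 in D. apply D.
    + apply (is_derive_ext (fun s => dot (rot c s (spin c x)) (X k))).
      * intros s; now rewrite spin_rot.
      * apply is_derive_dot_rot.
    + now apply is_derive_zonal.
    + intros; apply Rmult_comm. }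
rewrite (sumn_ext N _ (fun k => F 0%nat k + (F 1%nat k + F 2%nat k))).
- rewrite (sumn_plus N (F 0%nat)), (sumn_plus N (F 1%nat)), !H. ring.
- intros k Hk. specialize (HX k Hk). unfold on_sphere, F in *.
  (* Writing 1 as |x|^2 |x_k|^2 turns the claim into Lagrange's identity for cross products, a
     polynomial identity without side conditions. *)
  replace (1 - dot x (X k) * dot x (X k)) with
    (dot x x * dot (X k) (X k) - dot x (X k) * dot x (X k)) by (rewrite Hx, HX; ring).
  generalize (q (dot x (X k))) (q' (dot x (X k))).
  unfold dot, spin; simpl; intros; ring.
Qed.

(** A sum that is constant on the sphere has zero derivative along all rotations, which is the
    hypothesis of the preceding lemma. *)
Lemma sum_beltrami_eq0_of_const (N : nat) (X : nat -> V3) (r r' r'' : R -> R) (C : R) :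
  (forall k, (k < N)%nat -> on_sphere (X k)) ->
  (forall u, is_derive r u (r' u)) ->
  (forall u, is_derive r' u (r'' u)) ->
  (forall x, on_sphere x -> sumn N (fun k => r (dot x (X k))) = C) ->
  forall x, on_sphere x ->
    sumn N (fun k => (1 - dot x (X k) * dot x (X k)) * r'' (dot x (X k))
                     - 2 * dot x (X k) * r' (dot x (X k))) = 0.
Proof.
intros HX Hr Hr' HC. apply sum_beltrami_eq0_of_tangent; [assumption..|].
intros c x Hx.
apply (is_derive_const_eq0 (fun s => sumn N (fun k => r (dot (rot c s x) (X k)))) C 0).
- intros s; apply HC, rot_on_sphere, Hx.
- apply (is_derive_sumn N (fun k s => r (dot (rot c s x) (X k)))); intros k _.
  now apply is_derive_zonal.
Qed.

Lemma is_derive_legendre_sum (t : nat) (a : nat -> R) (u : R) :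
  is_derive (fun u => sumn t (fun m => a m * legendre (S m) u)) u
    (sumn t (fun m => a m * dlegendre (S m) u)).
Proof.
apply (is_derive_sumn t (fun m u => a m * legendre (S m) u)); intros m _.
apply is_derive_scal, is_derive_legendre.
Qed.

Lemma is_derive_dlegendre_sum (t : nat) (a : nat -> R) (u : R) :
  is_derive (fun u => sumn t (fun m => a m * dlegendre (S m) u)) u
    (sumn t (fun m => a m * ddlegendre (S m) u)).
Proof.
apply (is_derive_sumn t (fun m u => a m * dlegendre (S m) u)); intros m _.
apply is_derive_scal, is_derive_dlegendre.
Qed.

Lemma beltrami_legendre_sum (t : nat) (a : nat -> R) (u : R) :
  (1 - u * u) * sumn t (fun m => a m * ddlegendre (S m) u)
  - 2 * u * sumn t (fun m => a m * dlegendre (S m) u) =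
  sumn t (fun m => - (INR (S m) * (INR (S m) + 1)) * a m * legendre (S m) u).
Proof.
induction t as [|t IH]; [simpl; ring|].
cbn [sumn]. rewrite <- IH.
replace (- (INR (S t) * (INR (S t) + 1)) * a t * legendre (S t) u) with
  (a t * (- (INR (S t) * (INR (S t) + 1)) * legendre (S t) u)) by ring.
rewrite <- legendre_ode. ring.
Qed.

(* The eigenvalues -n(n+1) are distinct, so applying the Laplace-Beltrami operator
   plus T(T+1) removes the top term and keeps all other coefficients nonzero. *)
Lemma sum_legendre_eq0 (N : nat) (X : nat -> V3) (T : nat) (a : nat -> R) :
  (forall k, (k < N)%nat -> on_sphere (X k)) ->
  (forall m, (m < T)%nat -> a m <> 0) ->
  (forall x, on_sphere x -> sumn N (fun k =>
     sumn T (fun m => a m * legendre (S m) (dot x (X k)))) = 0) ->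
  forall m, (m < T)%nat -> forall x, on_sphere x ->
    sumn N (fun k => legendre (S m) (dot x (X k))) = 0.
Proof.
intros HX; revert a; induction T as [|T IH]; intros a Ha H0 m Hm x Hx; [lia|].
assert (HD : forall x, on_sphere x -> sumn N (fun k => sumn (S T) (fun m =>
    - (INR (S m) * (INR (S m) + 1)) * a m * legendre (S m) (dot x (X k)))) = 0).
{ intros z Hz.
  rewrite <- (sum_beltrami_eq0_of_const N X
    (fun u => sumn (S T) (fun m => a m * legendre (S m) u))
    (fun u => sumn (S T) (fun m => a m * dlegendre (S m) u))
    (fun u => sumn (S T) (fun m => a m * ddlegendre (S m) u)) 0 HX) with (x := z);
    try assumption.
  - apply sumn_ext; intros; now rewrite beltrami_legendre_sum.
  - apply is_derive_legendre_sum.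
  - apply is_derive_dlegendre_sum. }
set (l := fun n => INR (S n) * (INR (S n) + 1)).
assert (Hlow : forall m, (m < T)%nat -> forall x, on_sphere x ->
    sumn N (fun k => legendre (S m) (dot x (X k))) = 0).
{ apply (IH (fun m => (l T - l m) * a m)).
  - intros j Hj. apply Rmult_integral_contrapositive_currified; [|apply Ha; lia].
    assert (INR j < INR T) by (apply lt_INR; lia). pose proof (pos_INR j).
    unfold l; rewrite !S_INR; nra.
  - intros z Hz. specialize (HD z Hz); specialize (H0 z Hz).
    rewrite (sumn_ext N _ (fun k => l T * sumn (S T) (fun m => a m * legendre (S m) (dot z (X k)))
      + sumn (S T) (fun m => - l m * a m * legendre (S m) (dot z (X k))))).
    + rewrite sumn_plus, sumn_scal, H0. unfold l; rewrite HD; ring.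
    (* The terms of index T cancel, since [l T - l T] is zero. *)
    + intros k _. rewrite <- sumn_scal, <- sumn_plus; cbn [sumn].
      rewrite (sumn_ext T _ (fun i => l T * (a i * legendre (S i) (dot z (X k))) +
        - l i * a i * legendre (S i) (dot z (X k)))) by (intros; ring).
      ring. }
destruct (Nat.eq_dec m T) as [->|Ne]; [|apply Hlow; trivial; lia].
(* With the lower degrees gone, the original relation is [a T] times the wanted sum. *)
apply (Rmult_eq_reg_l (a T)); [|apply Ha; lia].
rewrite Rmult_0_r, <- (H0 x Hx), <- sumn_scal; cbn [sumn].
rewrite sumn_plus.
enough (sumn N (fun k => sumn T (fun m => a m * legendre (S m) (dot x (X k)))) = 0)
  by lra.
clear - Hlow Hx. induction T as [|T IH]; [apply sumn_zero|].
cbn [sumn]; rewrite sumn_plus, IH, sumn_scal, Hlow by (auto; intros; apply Hlow; auto; lia).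
ring.
Qed.

(** The three-term recursion writes u P_{n+1} as a combination of P_{n+2} and P_n. Hence the
    induction on m is run on the stronger claim for u^m P_n with m+n <= t, and n = 0 gives the
    powers. *)
Lemma sum_pow_const (N : nat) (X : nat -> V3) (t : nat) :
  (forall n, (1 <= n <= t)%nat -> forall x, on_sphere x ->
    sumn N (fun k => legendre n (dot x (X k))) = 0) ->
  forall m, (m <= t)%nat -> exists C, forall x, on_sphere x ->
    sumn N (fun k => dot x (X k) ^ m) = C.
Proof.
intros H0.
enough (H : forall m n, (m + n <= t)%nat -> exists C, forall x, on_sphere x ->
    sumn N (fun k => dot x (X k) ^ m * legendre n (dot x (X k))) = C).
{ intros m Hm. destruct (H m 0%nat) as [C HC]; [lia|].
  exists C; intros x Hx; rewrite <- (HC x Hx); apply sumn_ext; intros.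
  unfold legendre; simpl; ring. }
induction m as [|m IH]; intros n Hmn.
- destruct n as [|n].
  + exists (INR N); intros x _. rewrite <- sumn_one; apply sumn_ext; intros.
    unfold legendre; simpl; ring.
  + exists 0; intros x Hx. rewrite <- (H0 (S n) ltac:(lia) x Hx).
    apply sumn_ext; intros; simpl; ring.
- destruct n as [|n].
  + destruct (IH 1%nat ltac:(lia)) as [C HC]; exists C; intros x Hx.
    rewrite <- (HC x Hx); apply sumn_ext; intros; unfold legendre; simpl; ring.
  + destruct (IH (S (S n)) ltac:(lia)) as [C1 H1].
    destruct (IH n ltac:(lia)) as [C2 H2].
    exists (/ (2 * INR n + 3) * ((INR n + 2) * C1 + (INR n + 1) * C2)); intros x Hx.
    rewrite <- (H1 x Hx), <- (H2 x Hx), <- !sumn_scal, <- sumn_plus, <- sumn_scal.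
    apply sumn_ext; intros k _.
    pose proof (legendre_SS n (dot x (X k))). pose proof (pos_INR n).
    apply (Rmult_eq_reg_l (2 * INR n + 3)); [|lra].
    transitivity (dot x (X k) ^ m *
      ((INR n + 2) * legendre (S (S n)) (dot x (X k)) +
       (INR n + 1) * legendre n (dot x (X k)))).
    * rewrite H; cbn [pow]; ring.
    * field; lra.
Qed.

(** * Derivatives of powers and the Laplacian of ridge functions *)

Definition dpow (n : nat) (x : R) : R :=
  match n with 0%nat => 0 | S k => (INR k + 1) * x ^ k end.

Definition ddpow (n : nat) (x : R) : R :=
  match n with 0%nat => 0 | S k => (INR k + 1) * dpow k x end.

Lemma is_derive_powS (n : nat) (x : R) :
  is_derive (fun x => x ^ S n) x ((INR n + 1) * x ^ n).
Proof. rewrite <- S_INR. apply is_derive_Reals, (derivable_pt_lim_pow x (S n)). Qed.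

Lemma is_derive_id_pow (n : nat) (x : R) : is_derive (fun x => x ^ n) x (dpow n x).
Proof. destruct n; [apply (is_derive_const 1 x)|apply is_derive_powS]. Qed.

Lemma is_derive_dpow (n : nat) (x : R) : is_derive (dpow n) x (ddpow n x).
Proof.
destruct n; [apply (is_derive_const 0 x)|].
apply is_derive_scal, is_derive_id_pow.
Qed.

Lemma dpow_S (n : nat) (x : R) : dpow (S n) x = x ^ n + x * dpow n x.
Proof. destruct n; [simpl; ring|]. unfold dpow; rewrite S_INR; simpl; ring. Qed.

Lemma mul_dpow (n : nat) (x : R) : x * dpow n x = INR n * x ^ n.
Proof. destruct n; [simpl; ring|]. unfold dpow. rewrite S_INR; simpl; ring. Qed.

Lemma ddpow_S (n : nat) (x : R) : ddpow (S n) x = 2 * dpow n x + x * ddpow n x.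
Proof.
destruct n as [|n]; [simpl; ring|].
change (ddpow (S (S n)) x) with ((INR (S n) + 1) * dpow (S n) x).
change (ddpow (S n) x) with ((INR n + 1) * dpow n x).
rewrite S_INR, dpow_S.
replace (x * ((INR n + 1) * dpow n x)) with ((INR n + 1) * (x * dpow n x)) by ring.
rewrite mul_dpow; ring.
Qed.

(** The truncated exponent is harmless: for n < 2 the coefficient n(n-1) vanishes. *)
Lemma ddpow_pow (n : nat) (x : R) :
  ddpow n x = INR n * (INR n - 1) * x ^ (n - 2).
Proof.
destruct n as [|[|n]]; [simpl; ring..|].
unfold ddpow, dpow; rewrite !S_INR.
replace (S (S n) - 2)%nat with n by lia. ring.
Qed.

Lemma mul_ddpow (n : nat) (x : R) : x * x * ddpow n x = INR n * (INR n - 1) * x ^ n.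
Proof.
destruct n as [|[|n]]; [simpl; ring..|]. rewrite ddpow_pow.
replace (S (S n) - 2)%nat with n by lia. simpl pow; ring.
Qed.

(** The Legendre operator sends u^m to (u^m)'' - m(m+1) u^m, and its sum over the points vanishes
    because the power sum is constant. *)
Lemma sum_laplace_ridge_sphere (N : nat) (X : nat -> V3) (m : nat) (C : R) :
  (forall k, (k < N)%nat -> on_sphere (X k)) ->
  (forall x, on_sphere x -> sumn N (fun k => dot x (X k) ^ m) = C) ->
  forall x, on_sphere x ->
  sumn N (fun k => INR m * (INR m + 1) * dot x (X k) ^ m - ddpow m (dot x (X k))) = 0.
Proof.
intros HX HC x Hx.
pose proof (sum_beltrami_eq0_of_const N X (fun u => u ^ m) (dpow m) (ddpow m) C HX
  (is_derive_id_pow m) (is_derive_dpow m) HC x Hx) as H.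
rewrite <- (Rmult_0_r (-1)), <- H, <- sumn_scal; apply sumn_ext; intros k _.
set (u := dot x (X k)).
replace ((1 - u * u) * ddpow m u - 2 * u * dpow m u) with
  (ddpow m u - u * u * ddpow m u - 2 * (u * dpow m u)) by ring.
rewrite mul_dpow, mul_ddpow. ring.
Qed.

(** Extension from unit vectors by homogeneity of degree m; the factor [dot v v] restores the two
    degrees lost in [ddpow]. Read in the sample point y, the summand is m(m+1) p - Laplacian p for
    p(y) = (v.y)^m, and v is now free to be differentiated. *)
Lemma sum_laplace_ridge (N : nat) (X : nat -> V3) (m : nat) (C : R) :
  (forall k, (k < N)%nat -> on_sphere (X k)) ->
  (forall x, on_sphere x -> sumn N (fun k => dot x (X k) ^ m) = C) ->
  forall v, sumn N (fun k => INR m * (INR m + 1) * dot v (X k) ^ m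
                             - dot v v * ddpow m (dot v (X k))) = 0.
Proof.
intros HX HC v.
assert (Hv : 0 <= dot v v) by (unfold dot; nra).
destruct (Req_dec (dot v v) 0) as [E|E].
- assert (Z : forall y, dot v y = 0).
  { intros y. unfold dot in *.
    assert (v1 v = 0) by nra. assert (v2 v = 0) by nra. assert (v3 v = 0) by nra.
    rewrite H, H0, H1; ring. }
  rewrite <- (sumn_zero N); apply sumn_ext; intros k _. rewrite E, Z.
  destruct m; simpl; ring.
- set (r := sqrt (dot v v)).
  assert (Hr : r * r = dot v v) by now apply sqrt_sqrt.
  assert (r <> 0) by (intros Z; rewrite Z in Hr; lra).
  set (x := vscale (/ r) v).
  assert (Hvx : forall y, dot v y = r * dot x y).
  { intros y. unfold x, dot, vscale; simpl. field; assumption. }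
  assert (Hx : on_sphere x).
  { unfold on_sphere. unfold x. unfold dot at 1; simpl.
    transitivity (dot v v / (r * r)); [unfold dot; field; assumption|].
    rewrite Hr; field; assumption. }
  rewrite <- (Rmult_0_r (r ^ m)), <- (sum_laplace_ridge_sphere N X m C HX HC x Hx),
    <- sumn_scal; apply sumn_ext; intros k _.
  rewrite Hvx, <- Hr, !ddpow_pow.
  destruct m as [|[|m]]; [simpl; ring..|].
  replace (S (S m) - 2)%nat with m by lia.
  rewrite !Rpow_mult_distr. simpl pow. ring.
Qed.

(** * Stationary points *)

(** The index m stands for the degree m+1, since the kernel of A_{N,t} starts at degree 1. [dkernel]
    is the derivative of that kernel. *)
Definition kernel_coef (m : nat) : R := (2 * INR (S m) + 1) / (4 * PI).

Definition dkernel (t : nat) (u : R) : R :=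
  sumn t (fun m => kernel_coef m * dlegendre (S m) u).

Lemma kernel_coef_pos (m : nat) : 0 < kernel_coef m.
Proof.
pose proof PI_RGT_0. pose proof (pos_INR (S m)).
apply Rdiv_lt_0_compat; lra.
Qed.

Lemma dot_sym (x y : V3) : dot x y = dot y x.
Proof. unfold dot; ring. Qed.

(** The point x_i occurs in both slots of the double sum, which by symmetry doubles 4 pi to 8 pi.
    The diagonal term is covered too, as the Euclidean variation changes [dot (X i) (X i)]. *)
Lemma is_derive_A_Nt (N t : nat) (X : nat -> V3) (i : nat) (e : V3) :
  (i < N)%nat ->
  is_derive (fun s => A_Nt N t (upd X i (vadd (X i) (vscale s e)))) 0
    (8 * PI / (INR N * INR N) *
     sumn N (fun k => dkernel t (dot (X i) (X k)) * dot e (X k))).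
Proof.
intros Hi.
set (delta := fun j => if Nat.eqb j i then 1 else 0).
(* All points move, with velocity [delta j] times e; this replaces the case distinction in [upd] by
   one formula that can be differentiated termwise. *)
set (Z := fun (s : R) j => vadd (X j) (vscale (s * delta j) e)).
assert (HZ : forall s, upd X i (vadd (X i) (vscale s e)) = Z s).
{ intros s; extensionality j; unfold upd, Z, delta.
  destruct (Nat.eqb_spec j i) as [->|_].
  - now rewrite Rmult_1_r.
  - destruct (X j); unfold vadd, vscale; simpl; f_equal; ring. }
assert (E : 8 * PI / (INR N * INR N) *
    sumn N (fun k => dkernel t (dot (X i) (X k)) * dot e (X k)) =
  4 * PI / (INR N * INR N) * sumn N (fun j => sumn N (fun k =>
    (delta j * dot e (X k) + delta k * dot (X j) e) * dkernel t (dot (X j) (X k))))).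
{ rewrite (sumn_ext N (fun j => sumn N _) (fun j =>
    delta j * sumn N (fun k => dkernel t (dot (X j) (X k)) * dot e (X k)) +
    dkernel t (dot (X j) (X i)) * dot (X j) e)).
  - rewrite sumn_plus; unfold delta; rewrite sumn_delta by assumption.
    rewrite (sumn_ext N (fun k => dkernel t (dot (X k) (X i)) * dot (X k) e)
      (fun k => dkernel t (dot (X i) (X k)) * dot e (X k)))
      by (intros; now rewrite (dot_sym (X i)), (dot_sym e)).
    lra.
  - intros j _.
    rewrite <- (sumn_delta N i (fun k => dkernel t (dot (X j) (X k)) * dot (X j) e) Hi),
      <- sumn_scal, <- sumn_plus.
    apply sumn_ext; intros; unfold delta; ring. }
rewrite E.
apply (is_derive_ext (fun s => 4 * PI / (INR N * INR N) *
  sumn N (fun j => sumn N (fun k =>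
    (fun u => sumn t (fun m => kernel_coef m * legendre (S m) u)) (dot (Z s j) (Z s k)))))).
{ intros s; rewrite HZ; reflexivity. }
apply is_derive_scal.
apply (is_derive_sumn N (fun j s => sumn N (fun k =>
    (fun u => sumn t (fun m => kernel_coef m * legendre (S m) u)) (dot (Z s j) (Z s k)))));
  intros j _.
apply (is_derive_sumn N (fun k s =>
    (fun u => sumn t (fun m => kernel_coef m * legendre (S m) u)) (dot (Z s j) (Z s k))));
  intros k _.
apply (is_derive_comp (fun u => sumn t (fun m => kernel_coef m * legendre (S m) u))
  (fun s => dot (Z s j) (Z s k))).
- replace (dot (Z 0 j) (Z 0 k)) with (dot (X j) (X k))
    by (unfold Z, dot; simpl; ring).
  apply is_derive_legendre_sum.
- unfold Z, dot; simpl; auto_derive; trivial; ring.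
Qed.

(** The Euclidean gradient at x_i is a nonzero constant times the sum of [dkernel] (x_i.x_k) x_k,
    and tangential projection replaces x_k by x_k - (x_i.x_k) x_i. *)
Lemma stationary_tangent (N t : nat) (X : nat -> V3) (i c : nat) :
  (c < 3)%nat -> (i < N)%nat -> stationary N t X ->
  sumn N (fun k => dkernel t (dot (X i) (X k)) *
    (coord c (X k) - dot (X i) (X k) * coord c (X i))) = 0.
Proof.
intros Hc Hi Hst. destruct (Hst i Hi) as (g & Hg & Ht).
set (C := 8 * PI / (INR N * INR N)).
assert (HC : C <> 0).
{ assert (0 < INR N) by (apply lt_0_INR; lia). pose proof PI_RGT_0.
  apply Rgt_not_eq, Rdiv_lt_0_compat; nra. }
assert (Hgc : forall c, (c < 3)%nat -> coord c g =
  C * sumn N (fun k => dkernel t (dot (X i) (X k)) * coord c (X k))).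
{ intros c' Hc'.
  replace (fun k => dkernel t (dot (X i) (X k)) * coord c' (X k)) with
    (fun k => dkernel t (dot (X i) (X k)) * dot (e_coord c') (X k)).
  - pose proof (is_derive_A_Nt N t X i (e_coord c') Hi) as D.
    specialize (Hg c' Hc'). apply is_derive_Reals in Hg.
    apply is_derive_unique in Hg; apply is_derive_unique in D.
    exact (eq_trans (eq_sym Hg) D).
  - extensionality k; destruct c' as [|[|]]; unfold dot; simpl; ring. }
assert (Hdot : dot g (X i) =
  C * sumn N (fun k => dkernel t (dot (X i) (X k)) * dot (X i) (X k))).
{ unfold dot at 1.
  rewrite (Hgc 0%nat ltac:(lia) : v1 g = _), (Hgc 1%nat ltac:(lia) : v2 g = _),
    (Hgc 2%nat ltac:(lia) : v3 g = _).
  rewrite (sumn_ext N (fun k => dkernel t (dot (X i) (X k)) * dot (X i) (X k)) (fun k =>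
    v1 (X i) * (dkernel t (dot (X i) (X k)) * coord 0 (X k)) +
    (v2 (X i) * (dkernel t (dot (X i) (X k)) * coord 1 (X k)) +
     v3 (X i) * (dkernel t (dot (X i) (X k)) * coord 2 (X k))))).
  - rewrite !sumn_plus, !sumn_scal; ring.
  - intros k _. generalize (dkernel t (dot (X i) (X k))); intros r.
    unfold dot; simpl; ring. }
assert (Hcg : coord c g = dot g (X i) * coord c (X i)).
{ apply (f_equal (coord c)) in Ht.
  replace (coord c vzero) with 0 in Ht by (destruct c as [|[|]]; reflexivity).
  replace (coord c (vsub g (vscale (dot g (X i)) (X i)))) with
    (coord c g - dot g (X i) * coord c (X i)) in Ht
    by (destruct c as [|[|]]; simpl; ring).
  lra. }
rewrite Hgc, Hdot in Hcg by assumption.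
apply (Rmult_eq_reg_l C); [|assumption].
rewrite Rmult_0_r.
rewrite (sumn_ext N _ (fun k => dkernel t (dot (X i) (X k)) * coord c (X k) +
  - coord c (X i) * (dkernel t (dot (X i) (X k)) * dot (X i) (X k)))) by (intros; ring).
rewrite sumn_plus, sumn_scal. lra.
Qed.

(** The kernel derivative has degree t-1, and the factors [dot x (X k)] and [coord c x] add two.
    This is why the basis matrix is taken in degree t+1. *)
Lemma is_poly_tangent (N t : nat) (X : nat -> V3) (c : nat) :
  is_poly (t + 1) (fun x => sumn N (fun k => dkernel t (dot x (X k)) *
    (coord c (X k) - dot x (X k) * coord c x))).
Proof.
apply is_poly_sumn; intros k _.
(* For t = 0 the degree t-1 makes no sense, but the kernel is an empty sum. *)
destruct t as [|t].
{ replace (fun x => _) with (fun _ : V3 => 0)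
    by (extensionality x; unfold dkernel; simpl; ring).
  apply is_poly_zero. }
assert (HK : is_poly t (fun x => dkernel (S t) (dot x (X k)))).
{ apply (is_poly_sumn t (S t) (fun m x => kernel_coef m * dlegendre (S m) (dot x (X k)))).
  intros m Hm. apply is_poly_scal, (is_poly_le m); [lia|]. apply is_poly_dlegendre. }
replace (fun x => _) with (fun x => coord c (X k) * dkernel (S t) (dot x (X k)) +
  -1 * (coord c x * (dot x (X k) * dkernel (S t) (dot x (X k)))))
  by (extensionality x; ring).
apply is_poly_plus; apply is_poly_scal.
- apply (is_poly_le t); [lia|exact HK].
- replace (S t + 1)%nat with (S (S t)) by lia. now apply is_poly_coord, is_poly_dot.
Qed.

(** Vanishing at the samples means that the transposed basis matrix kills the coefficient vector of
    p. If that vector were nonzero, normalizing it would give a unit vector with image 0, against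
    [0 < sigma]. *)
Lemma poly_eq0_of_sample (s N : nat) (X : nat -> V3) (Y : nat -> V3 -> R)
    (sigma : R) (p : V3 -> R) :
  (forall q, is_poly s q -> exists a : nat -> R,
     forall v, on_sphere v -> q v = sumn ((s + 1) * (s + 1)) (fun j => a j * Y j v)) ->
  min_singular_value ((s + 1) * (s + 1)) N (basis_matrix Y X) sigma -> 0 < sigma ->
  (forall i, (i < N)%nat -> on_sphere (X i)) ->
  is_poly s p -> (forall i, (i < N)%nat -> p (X i) = 0) ->
  forall x, on_sphere x -> p x = 0.
Proof.
set (M := ((s + 1) * (s + 1))%nat). intros Hspan [_ Hmin] Hsig HX Hp Hp0 x Hx.
destruct (Hspan p Hp) as [a Ha].
assert (Hn : 0 <= sumn M (fun j => a j ^ 2))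
  by (apply sumn_nonneg; intros; apply pow2_ge_0).
destruct (Req_dec (sumn M (fun j => a j ^ 2)) 0) as [Z|Z].
- rewrite Ha by assumption. rewrite <- (sumn_zero M); apply sumn_ext; intros j Hj.
  rewrite (sumn_sq_eq0 M a Z j Hj); ring.
- exfalso. set (r := sqrt (sumn M (fun j => a j ^ 2))).
  assert (Hr : r * r = sumn M (fun j => a j ^ 2)) by now apply sqrt_sqrt.
  assert (Hr0 : r <> 0) by (intros E; rewrite E in Hr; lra).
  specialize (Hmin (fun j => / r * a j)); cbv beta in Hmin.
  rewrite (sumn_ext M (fun j => (/ r * a j) ^ 2) (fun j => / (r * r) * a j ^ 2)) in Hmin
    by (intros; field; assumption).
  rewrite sumn_scal, Hr in Hmin. specialize (Hmin (Rinv_l _ Z)).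
  rewrite (sumn_ext N _ (fun _ => 0)), sumn_zero, sqrt_0 in Hmin; [lra|].
  intros i Hi. unfold basis_matrix.
  rewrite (sumn_ext M _ (fun j => / r * (a j * Y j (X i)))) by (intros; ring).
  rewrite sumn_scal, <- Ha, Hp0 by auto. ring.
Qed.

(** Since [spin c x] is orthogonal to x, pairing it with x_k is the same as pairing it with the
    tangential part of x_k. *)
Lemma sum_tangent_spin (N : nat) (X : nat -> V3) (q : R -> R) (x : V3) :
  (forall c, (c < 3)%nat ->
    sumn N (fun k => q (dot x (X k)) * (coord c (X k) - dot x (X k) * coord c x)) = 0) ->
  forall c, sumn N (fun k => dot (spin c x) (X k) * q (dot x (X k))) = 0.
Proof.
intros H c.
rewrite (sumn_ext N _ (fun k =>
  v1 (spin c x) * (q (dot x (X k)) * (coord 0 (X k) - dot x (X k) * coord 0 x)) +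
  (v2 (spin c x) * (q (dot x (X k)) * (coord 1 (X k) - dot x (X k) * coord 1 x)) +
   v3 (spin c x) * (q (dot x (X k)) * (coord 2 (X k) - dot x (X k) * coord 2 x))))).
- rewrite !sumn_plus, !sumn_scal, !H by lia. ring.
- intros k _. generalize (q (dot x (X k))) as r; intros r.
  unfold dot; destruct c as [|[|]]; simpl; ring.
Qed.

(** * Moments *)

(* Value, gradient and Laplacian at [x] of the product of the linear forms
   [dot w], [w] in [ws]. *)
Fixpoint prod_val (ws : list V3) (x : V3) : R :=
  match ws with nil => 1 | w :: r => dot w x * prod_val r x end.

Fixpoint prod_grad (ws : list V3) (x : V3) : V3 :=
  match ws with
  | nil => vzero
  | w :: r => vadd (vscale (prod_val r x) w) (vscale (dot w x) (prod_grad r x))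
  end.

Fixpoint prod_lap (ws : list V3) (x : V3) : R :=
  match ws with
  | nil => 0
  | w :: r => 2 * dot w (prod_grad r x) + dot w x * prod_lap r x
  end.

(* [lam * p - Laplacian p] for [p x = (dot v x)^k * prod_val ws x]; its derivative
   in [v] along [w] trades a factor [dot v x] for [dot w x], which leads from
   ridge powers to arbitrary products of linear forms. *)
Definition lap_defect (lam : R) (k : nat) (ws : list V3) (v x : V3) : R :=
  lam * dot v x ^ k * prod_val ws x
  - (dot v v * ddpow k (dot v x) * prod_val ws x
     + 2 * dpow k (dot v x) * dot v (prod_grad ws x)
     + dot v x ^ k * prod_lap ws x).

Lemma is_derive_lap_defect (lam : R) (k : nat) (ws : list V3) (w v x : V3) :
  is_derive (fun s => lap_defect lam (S k) ws (vadd v (vscale s w)) x) 0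
    ((INR k + 1) * lap_defect lam k (w :: ws) v x).
Proof.
set (u := fun s => dot v x + s * dot w x).
assert (Du : is_derive u 0 (dot w x)) by (unfold u; auto_derive; trivial; ring).
assert (u0 : u 0 = dot v x) by (unfold u; ring).
assert (D1 : forall (f : R -> R) d, is_derive f (dot v x) d ->
  is_derive (fun s => f (u s)) 0 (dot w x * d)).
{ intros f d Hf. apply (is_derive_comp f u); [now rewrite u0|exact Du]. }
pose proof (D1 _ _ (is_derive_id_pow (S k) (dot v x))) as Dp.
pose proof (D1 _ _ (is_derive_dpow (S k) (dot v x))) as Ddp.
assert (Dddp : is_derive (fun s => ddpow (S k) (u s)) 0
  (dot w x * ((INR k + 1) * ddpow k (dot v x)))).
{ apply D1. apply is_derive_scal, is_derive_dpow. }
apply (is_derive_ext (fun s => lam * u s ^ S k * prod_val ws x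
  - ((dot v v + 2 * s * dot v w + s * s * dot w w) * ddpow (S k) (u s) * prod_val ws x
     + 2 * dpow (S k) (u s) * (dot v (prod_grad ws x) + s * dot w (prod_grad ws x))
     + u s ^ S k * prod_lap ws x))).
{ intros s. unfold lap_defect.
  replace (dot (vadd v (vscale s w)) x) with (u s)
    by (unfold u, dot; simpl; ring).
  replace (dot (vadd v (vscale s w)) (vadd v (vscale s w))) with
    (dot v v + 2 * s * dot v w + s * s * dot w w) by (unfold dot; simpl; ring).
  replace (dot (vadd v (vscale s w)) (prod_grad ws x)) with
    (dot v (prod_grad ws x) + s * dot w (prod_grad ws x))
    by (unfold dot; simpl; ring).
  reflexivity. }
cbv beta in Dp, Ddp.
(* Under these names [auto_derive] treats the composites as unknown functions and leaves [Derive]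
   terms, whose values are E0, E1 and E2. *)
set (f0 := fun s => u s ^ S k) in Dp.
set (f1 := fun s => dpow (S k) (u s)) in Ddp.
set (f2 := fun s => ddpow (S k) (u s)) in Dddp.
apply (is_derive_ext (fun s => lam * f0 s * prod_val ws x
  - ((dot v v + 2 * s * dot v w + s * s * dot w w) * f2 s * prod_val ws x
     + 2 * f1 s * (dot v (prod_grad ws x) + s * dot w (prod_grad ws x))
     + f0 s * prod_lap ws x))); [reflexivity|].
assert (E0 : Derive (fun s => f0 s) 0 = dot w x * dpow (S k) (dot v x))
  by (apply is_derive_unique; exact Dp).
assert (E1 : Derive (fun s => f1 s) 0 = dot w x * ddpow (S k) (dot v x))
  by (apply is_derive_unique; exact Ddp).
assert (E2 : Derive (fun s => f2 s) 0 = dot w x * ((INR k + 1) * ddpow k (dot v x)))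
  by (apply is_derive_unique; exact Dddp).
auto_derive.
- repeat split; eexists; eassumption.
- rewrite E0, E1, E2. unfold f0, f1, f2. rewrite !u0. unfold lap_defect.
  cbn [prod_val prod_grad prod_lap].
  replace (dot v (vadd (vscale (prod_val ws x) w) (vscale (dot w x) (prod_grad ws x))))
    with (prod_val ws x * dot v w + dot w x * dot v (prod_grad ws x))
    by (unfold dot; simpl; ring).
  replace (ddpow (S k) (dot v x)) with ((INR k + 1) * dpow k (dot v x)) by reflexivity.
  replace (dpow (S k) (dot v x)) with ((INR k + 1) * dot v x ^ k) by reflexivity.
  ring.
Qed.

(** Polarization: from the pure power k = m, each derivative in v along w moves one factor into the
    list, up to the nonzero factor k+1. *)
Lemma sum_lap_defect_eq0 (N : nat) (X : nat -> V3) (lam : R) (m : nat) :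
  (forall v, sumn N (fun i => lap_defect lam m nil v (X i)) = 0) ->
  forall ws k, (k + length ws = m)%nat ->
  forall v, sumn N (fun i => lap_defect lam k ws v (X i)) = 0.
Proof.
intros H0 ws; induction ws as [|w ws IH]; intros k Hk v.
- simpl in Hk. rewrite Nat.add_0_r in Hk; subst k; apply H0.
- simpl in Hk. pose proof (pos_INR k) as Pk.
  apply (Rmult_eq_reg_l (INR k + 1)); [|lra].
  rewrite Rmult_0_r, <- sumn_scal.
  apply (is_derive_const_eq0
    (fun s => sumn N (fun i => lap_defect lam (S k) ws (vadd v (vscale s w)) (X i))) 0 0).
  + intros s; apply IH; lia.
  + apply (is_derive_sumn N
      (fun i s => lap_defect lam (S k) ws (vadd v (vscale s w)) (X i))); intros i _.
    apply is_derive_lap_defect.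
Qed.

Definition mono_forms (a b c : nat) : list V3 :=
  repeat (e_coord 0) a ++ repeat (e_coord 1) b ++ repeat (e_coord 2) c.

Lemma mono_forms_jet (a b c : nat) (x : V3) :
  prod_val (mono_forms a b c) x = mono a b c x /\
  prod_grad (mono_forms a b c) x =
    mkV3 (dpow a (v1 x) * v2 x ^ b * v3 x ^ c)
         (v1 x ^ a * dpow b (v2 x) * v3 x ^ c)
         (v1 x ^ a * v2 x ^ b * dpow c (v3 x)) /\
  prod_lap (mono_forms a b c) x =
    ddpow a (v1 x) * v2 x ^ b * v3 x ^ c + v1 x ^ a * ddpow b (v2 x) * v3 x ^ c
    + v1 x ^ a * v2 x ^ b * ddpow c (v3 x).
Proof.
destruct x as [x y z]; unfold mono, mono_forms; cbn [v1 v2 v3].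
induction a as [|a (Ev & Eg & El)].
- induction b as [|b (Ev & Eg & El)].
  + induction c as [|c (Ev & Eg & El)].
    * cbn; split; [ring|split; [unfold vzero; f_equal; ring|ring]].
    * cbn [repeat app] in *; cbn [prod_val prod_grad prod_lap].
      rewrite Ev, Eg, El, dpow_S, ddpow_S. unfold dot, vadd, vscale; cbn.
      split; [ring|split; [f_equal; ring|ring]].
  + cbn [repeat app] in *; cbn [prod_val prod_grad prod_lap].
    rewrite Ev, Eg, El, dpow_S, ddpow_S. unfold dot, vadd, vscale; cbn.
    split; [ring|split; [f_equal; ring|ring]].
- cbn [repeat app] in *; cbn [prod_val prod_grad prod_lap].
  rewrite Ev, Eg, El, dpow_S, ddpow_S. unfold dot, vadd, vscale; cbn.
  split; [ring|split; [f_equal; ring|ring]].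
Qed.

Lemma length_mono_forms (a b c : nat) : length (mono_forms a b c) = (a + b + c)%nat.
Proof. unfold mono_forms. rewrite !length_app, !repeat_length. lia. Qed.

Lemma sum_mono_rec (N : nat) (X : nat -> V3) (a b c : nat) (C : R) :
  (forall k, (k < N)%nat -> on_sphere (X k)) ->
  (forall x, on_sphere x -> sumn N (fun k => dot x (X k) ^ (a + b + c)) = C) ->
  let mu p := sumn N (fun k => p (X k)) in
  INR (a + b + c) * (INR (a + b + c) + 1) * mu (mono a b c) =
  INR a * (INR a - 1) * mu (mono (a - 2) b c) +
  INR b * (INR b - 1) * mu (mono a (b - 2) c) +
  INR c * (INR c - 1) * mu (mono a b (c - 2)).
Proof.
intros HX HC mu; unfold mu. set (m := (a + b + c)%nat) in *.
pose proof (sum_lap_defect_eq0 N X (INR m * (INR m + 1)) m) as H.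
specialize (H ltac:(intros v; rewrite <- (sum_laplace_ridge N X m C HX HC v);
  apply sumn_ext; intros; unfold lap_defect, dot; simpl; ring)).
(* With k = 0 all forms sit in the list and v survives only in a zeroth power, so [vzero] is as good
   as any vector. *)
specialize (H (mono_forms a b c) 0%nat (length_mono_forms a b c) vzero).
apply Rminus_diag_uniq. rewrite <- H.
unfold Rminus. rewrite <- !sumn_scal, <- !sumn_plus.
match goal with |- ?l + - ?r = _ => replace (- r) with (-1 * r) by ring end.
rewrite <- sumn_scal, <- sumn_plus. apply sumn_ext; intros k _.
unfold lap_defect. destruct (mono_forms_jet a b c (X k)) as (-> & _ & ->).
rewrite !ddpow_pow. unfold mono. simpl (dpow 0 _); simpl (dot _ _ ^ 0).
simpl (INR 0). ring.
Qed.

(** * Trigonometric integrals, moments of the sphere, and their comparison with point sums *)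

Definition sincos (p q : nat) (l h : R) : R :=
  RInt (fun x => sin x ^ p * cos x ^ q) l h.

Lemma is_RInt_sincos (p q : nat) (l h : R) :
  is_RInt (fun x => sin x ^ p * cos x ^ q) l h (sincos p q l h).
Proof.
apply (@RInt_correct R_CompleteNormedModule), ex_RInt_continuous; intros x _.
apply (@ex_derive_continuous R_AbsRing R_NormedModule).
auto_derive; trivial.
Qed.

Lemma is_derive_sin_cos_pow (p q : nat) (x : R) :
  is_derive (fun x => sin x ^ p * cos x ^ q) x
    (dpow p (sin x) * cos x ^ S q - sin x ^ S p * dpow q (cos x)).
Proof.
replace (dpow p (sin x) * cos x ^ S q - sin x ^ S p * dpow q (cos x)) with
  (cos x * dpow p (sin x) * cos x ^ q + sin x ^ p * (- sin x * dpow q (cos x)))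
  by (simpl; ring).
apply (is_derive_mult (fun x => sin x ^ p) (fun x => cos x ^ q)).
- apply (is_derive_comp (fun u => u ^ p) sin); [apply is_derive_id_pow|apply is_derive_sin].
- apply (is_derive_comp (fun u => u ^ q) cos); [apply is_derive_id_pow|apply is_derive_cos].
- intros; apply Rmult_comm.
Qed.

Lemma is_RInt_eq (f g : R -> R) (a b l : R) :
  (forall x, f x = g x) -> is_RInt f a b l -> is_RInt g a b l.
Proof. intros H; apply is_RInt_ext; intros; apply H. Qed.

Lemma is_RInt_zero (a b : R) : is_RInt (fun _ => 0) a b 0.
Proof.
assert (H : is_RInt (fun _ => 0) a b ((b - a) * 0))
  by apply (@is_RInt_const R_NormedModule).
now rewrite Rmult_0_r in H.
Qed.

Lemma dpow_pred (n : nat) (x : R) : dpow n x = INR n * x ^ (n - 1).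
Proof.
destruct n; [simpl; ring|]. unfold dpow; rewrite S_INR.
replace (S n - 1)%nat with n by lia. reflexivity.
Qed.

(** Integration by parts: the derivative of sin^p cos^q integrates to 0 because its boundary values
    agree. A truncated exponent occurs only with coefficient 0. *)
Lemma sincos_parts (p q : nat) (l h : R) :
  sin h ^ p * cos h ^ q = sin l ^ p * cos l ^ q ->
  INR p * sincos (p - 1) (S q) l h = INR q * sincos (S p) (q - 1) l h.
Proof.
intros Hb.
assert (H1 : is_RInt (fun x => dpow p (sin x) * cos x ^ S q - sin x ^ S p * dpow q (cos x))
  l h 0).
{ replace 0 with (minus (sin h ^ p * cos h ^ q) (sin l ^ p * cos l ^ q))
    by (apply Rminus_diag_eq, Hb).
  apply (is_RInt_derive (fun x => sin x ^ p * cos x ^ q)).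
  - intros; apply is_derive_sin_cos_pow.
  - intros x _.
    apply (continuous_ext (fun x => INR p * sin x ^ (p - 1) * cos x ^ S q -
      sin x ^ S p * (INR q * cos x ^ (q - 1)))).
    + intros; now rewrite !dpow_pred.
    + apply (@ex_derive_continuous R_AbsRing R_NormedModule); auto_derive; trivial. }
assert (H2 : is_RInt (fun x => dpow p (sin x) * cos x ^ S q - sin x ^ S p * dpow q (cos x))
  l h (INR p * sincos (p - 1) (S q) l h - INR q * sincos (S p) (q - 1) l h)).
{ apply (is_RInt_eq (fun x => INR p * (sin x ^ (p - 1) * cos x ^ S q) -
    INR q * (sin x ^ S p * cos x ^ (q - 1)))).
  - intros; rewrite !dpow_pred; ring.
  - apply (@is_RInt_minus R_NormedModule);
      apply (@is_RInt_scal R_NormedModule), is_RInt_sincos. }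
apply Rminus_diag_uniq. exact (eq_trans (eq_sym (is_RInt_unique _ _ _ _ H2))
  (is_RInt_unique _ _ _ _ H1)).
Qed.

Lemma sincos_split (p q : nat) (l h : R) :
  sincos p q l h = sincos (S (S p)) q l h + sincos p (S (S q)) l h.
Proof.
apply is_RInt_unique.
apply (is_RInt_eq (fun x => sin x ^ S (S p) * cos x ^ q + sin x ^ p * cos x ^ S (S q))).
- intros x. pose proof (sin2_cos2 x) as E; unfold Rsqr in E.
  transitivity (sin x ^ p * cos x ^ q * (sin x * sin x + cos x * cos x));
    [simpl; ring|rewrite E; simpl; ring].
- apply (@is_RInt_plus R_NormedModule); apply is_RInt_sincos.
Qed.

(** The Wallis recursion, from integration by parts and sin^2 + cos^2 = 1; for q = 0 it says that
    the integral vanishes. *)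
Lemma sincos_cos_rec (p q : nat) (l h : R) :
  sin h ^ S p * cos h ^ q = sin l ^ S p * cos l ^ q ->
  (INR p + INR q + 1) * sincos p (S q) l h = INR q * sincos p (q - 1) l h.
Proof.
intros Hb; pose proof (sincos_parts (S p) q l h Hb) as H.
replace (S p - 1)%nat with p in H by lia.
rewrite S_INR in H. destruct q as [|q]; [simpl INR in *; lra|].
pose proof (sincos_split p q l h) as E.
replace (S q - 1)%nat with q in * by lia.
rewrite E. lra.
Qed.

Lemma sincos_sin_rec (p q : nat) (l h : R) :
  sin h ^ p * cos h ^ S q = sin l ^ p * cos l ^ S q ->
  (INR p + INR q + 1) * sincos (S p) q l h = INR p * sincos (p - 1) q l h.
Proof.
intros Hb; pose proof (sincos_parts p (S q) l h Hb) as H.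
replace (S q - 1)%nat with q in H by lia.
rewrite S_INR in H. destruct p as [|p]; [simpl INR in *; lra|].
pose proof (sincos_split p q l h) as E.
replace (S p - 1)%nat with p in * by lia.
rewrite E. lra.
Qed.

(** The surface integral of [mono a b c], factored in spherical coordinates; the extra 1 in the
    exponent is the sine of the area element. *)
Definition sphere_moment (a b c : nat) : R :=
  sincos (a + b + 1) c 0 PI * sincos b a 0 (2 * PI).

Lemma sphere_moment_0 : sphere_moment 0 0 0 = 4 * PI.
Proof.
assert (H1 : sincos 1 0 0 PI = 2).
{ apply is_RInt_unique.
  replace 2 with (minus (- cos PI) (- cos 0))
    by (rewrite cos_PI, cos_0; unfold minus, plus, opp; simpl; ring).
  apply (is_RInt_derive (fun x => - cos x)).
  - intros; auto_derive; trivial; ring.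
  - intros; apply (@ex_derive_continuous R_AbsRing R_NormedModule); auto_derive; trivial. }
assert (H2 : sincos 0 0 0 (2 * PI) = 2 * PI).
{ apply is_RInt_unique.
  apply (is_RInt_eq (fun _ => 1)); [intros; simpl; ring|].
  replace (2 * PI) with (scal (2 * PI - 0) 1) at 2
    by (unfold scal; simpl; unfold mult; simpl; ring).
  apply (@is_RInt_const R_NormedModule). }
unfold sphere_moment; simpl Nat.add; rewrite H1, H2; ring.
Qed.

(** With m = a+b+c, each exponent n among a, b, c satisfies its own identity: n(m+1) times the
    moment is n(n-1) times the moment with n lowered by two. The three identities add up to the
    claim. *)
Lemma sphere_moment_rec (a b c : nat) :
  INR (a + b + c) * (INR (a + b + c) + 1) * sphere_moment a b c =
  INR a * (INR a - 1) * sphere_moment (a - 2) b c +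
  INR b * (INR b - 1) * sphere_moment a (b - 2) c +
  INR c * (INR c - 1) * sphere_moment a b (c - 2).
Proof.
set (m1 := INR a + INR b + INR c + 1).
assert (Hc : INR c * m1 * sphere_moment a b c =
  INR c * (INR c - 1) * sphere_moment a b (c - 2)).
{ destruct c as [|c]; [simpl; ring|]. unfold sphere_moment.
  pose proof (sincos_cos_rec (a + b + 1) c 0 PI) as H.
  specialize (H ltac:(rewrite sin_PI, sin_0; simpl; ring)).
  replace (S c - 2)%nat with (c - 1)%nat by lia.
  transitivity ((INR c + 1) * ((INR (a + b + 1) + INR c + 1) *
    sincos (a + b + 1) (S c) 0 PI) * sincos b a 0 (2 * PI)).
  - unfold m1; rewrite !plus_INR, S_INR; simpl; ring.
  - rewrite H, S_INR; ring. }
(* Lowering a or b also lowers the sine power in the polar integral. The factor a+b that appears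
   here is absorbed by the azimuthal recursion. *)
assert (Hn : forall d, (d + 2 = a + b + 1)%nat -> m1 * sincos (a + b + 1) c 0 PI =
  (INR a + INR b) * sincos d c 0 PI).
{ intros d Hd. pose proof (sincos_sin_rec (S d) c 0 PI) as H.
  specialize (H ltac:(rewrite sin_PI, sin_0; simpl; ring)).
  replace (a + b + 1)%nat with (S (S d)) by lia.
  replace (S d - 1)%nat with d in H by lia.
  assert (E : INR (S d) = INR a + INR b)
    by (rewrite <- plus_INR; f_equal; lia).
  rewrite E in H. exact H. }
assert (Ha : INR a * m1 * sphere_moment a b c =
  INR a * (INR a - 1) * sphere_moment (a - 2) b c).
{ destruct a as [|a]; [simpl; ring|]. unfold sphere_moment.
  pose proof (sincos_cos_rec b a 0 (2 * PI)) as H.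
  specialize (H ltac:(rewrite sin_2PI, sin_0; simpl; ring)).
  transitivity (INR (S a) * (m1 * sincos (S a + b + 1) c 0 PI) *
    sincos b (S a) 0 (2 * PI)); [ring|].
  rewrite (Hn (a + b)%nat) by lia.
  transitivity (INR (S a) * sincos (a + b) c 0 PI *
    ((INR b + INR a + 1) * sincos b (S a) 0 (2 * PI))); [rewrite S_INR; ring|].
  rewrite H. destruct a as [|a]; [simpl; ring|].
  replace (S (S a) - 2)%nat with a by lia. replace (S a - 1)%nat with a by lia.
  replace (a + b + 1)%nat with (S a + b)%nat by lia. rewrite !S_INR; ring. }
assert (Hb : INR b * m1 * sphere_moment a b c =
  INR b * (INR b - 1) * sphere_moment a (b - 2) c).
{ destruct b as [|b]; [simpl; ring|]. unfold sphere_moment.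
  pose proof (sincos_sin_rec b a 0 (2 * PI)) as H.
  specialize (H ltac:(rewrite sin_2PI, sin_0, cos_2PI, cos_0, !pow1; reflexivity)).
  transitivity (INR (S b) * (m1 * sincos (a + S b + 1) c 0 PI) *
    sincos (S b) a 0 (2 * PI)); [ring|].
  rewrite (Hn (a + b)%nat) by lia.
  transitivity (INR (S b) * sincos (a + b) c 0 PI *
    ((INR b + INR a + 1) * sincos (S b) a 0 (2 * PI))); [rewrite S_INR; ring|].
  rewrite H. destruct b as [|b]; [simpl; ring|].
  replace (S (S b) - 2)%nat with b by lia. replace (S b - 1)%nat with b by lia.
  replace (a + b + 1)%nat with (a + S b)%nat by lia. rewrite !S_INR; ring. }
rewrite <- Ha, <- Hb, <- Hc. unfold m1; rewrite !plus_INR; ring.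
Qed.

(** Both sides obey the same recursion, whose leading factor m(m+1) is nonzero for m > 0, and both
    equal 4 pi N in degree 0. *)
Lemma sum_mono_moment (N t : nat) (X : nat -> V3) :
  (forall k, (k < N)%nat -> on_sphere (X k)) ->
  (forall m, (m <= t)%nat -> exists C, forall x, on_sphere x ->
    sumn N (fun k => dot x (X k) ^ m) = C) ->
  forall a b c, (a + b + c <= t)%nat ->
  4 * PI * sumn N (fun k => mono a b c (X k)) = INR N * sphere_moment a b c.
Proof.
intros HX HC.
enough (H : forall m a b c, (a + b + c <= m)%nat -> (a + b + c <= t)%nat ->
  4 * PI * sumn N (fun k => mono a b c (X k)) = INR N * sphere_moment a b c)
  by (intros; now apply (H t)).
induction m as [|m IH]; intros a b c Hm Ht.
- assert (a = 0 /\ b = 0 /\ c = 0)%nat as (-> & -> & ->) by lia.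
  rewrite sphere_moment_0, (sumn_ext N _ (fun _ => 1)), sumn_one; [ring|].
  intros; unfold mono; simpl; ring.
- destruct (Nat.eq_dec (a + b + c) 0) as [E|E]; [apply IH; lia|].
  assert (Hpos : 0 < INR (a + b + c)) by (apply lt_0_INR; lia).
  apply (Rmult_eq_reg_l (INR (a + b + c) * (INR (a + b + c) + 1))); [|nra].
  destruct (HC (a + b + c)%nat Ht) as [C HCm].
  pose proof (sum_mono_rec N X a b c C HX HCm) as H1; cbv beta zeta in H1.
  pose proof (sphere_moment_rec a b c) as H2.
  (* For n < 2 the coefficient n(n-1) vanishes, so the induction hypothesis is called only for
     genuine exponents n-2. *)
  assert (step : forall n x y, ((2 <= n)%nat -> 4 * PI * x = INR N * y) ->
    4 * PI * (INR n * (INR n - 1) * x) = INR N * (INR n * (INR n - 1) * y)).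
  { intros n x y H. destruct n as [|[|n]]; [simpl; ring..|].
    transitivity (INR (S (S n)) * (INR (S (S n)) - 1) * (4 * PI * x)); [ring|].
    rewrite H by lia. ring. }
  transitivity (4 * PI * (INR (a + b + c) * (INR (a + b + c) + 1) *
    sumn N (fun k => mono a b c (X k)))); [ring|].
  transitivity (INR N * (INR (a + b + c) * (INR (a + b + c) + 1) *
    sphere_moment a b c)); [|ring].
  rewrite H1, H2, !Rmult_plus_distr_l.
  f_equal; [f_equal|]; apply step; intros; apply IH; lia.
Qed.

(** * From moments to the design property *)

Lemma sphere_integral_intro (p : V3 -> R) (J : R -> R) (I : R) :
  (forall ph, is_RInt (fun th => p (sph th ph) * sin th) 0 PI (J ph)) ->
  is_RInt J 0 (2 * PI) I -> sphere_integral p I.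
Proof.
intros HJ HI.
set (pr := fun ph => ex_RInt_Reals_0 _ _ _ (ex_intro _ _ (HJ ph)) :
  Riemann_integrable (fun th => p (sph th ph) * sin th) 0 PI).
exists pr.
assert (E : J = fun ph => RiemannInt (pr ph)).
{ extensionality ph. rewrite <- RInt_Reals. symmetry; apply is_RInt_unique, HJ. }
rewrite E in HI.
exists (ex_RInt_Reals_0 _ _ _ (ex_intro _ _ HI)).
rewrite <- RInt_Reals; apply is_RInt_unique, HI.
Qed.

Lemma design_of_moments (N t : nat) (X : nat -> V3) :
  (0 < N)%nat ->
  (forall a b c, (a + b + c <= t)%nat ->
    4 * PI * sumn N (fun k => mono a b c (X k)) = INR N * sphere_moment a b c) ->
  spherical_design N t X.
Proof.
intros HN Hmom p Hp.
assert (HN' : 0 < INR N) by now apply lt_0_INR.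
pose proof PI_RGT_0 as HPI.
(* With the value of the integral fixed as 4 pi / N times the point sum, the claim is stable under
   sums; the inner integral J stays existential so that [is_poly_elim] can combine the pieces. *)
enough (H : exists J, (forall ph, is_RInt (fun th => p (sph th ph) * sin th) 0 PI (J ph)) /\
  is_RInt J 0 (2 * PI) (4 * PI * / INR N * sumn N (fun k => p (X k)))).
{ destruct H as (J & H1 & H2). eexists; split; [apply (sphere_integral_intro p J _ H1 H2)|].
  field; lra. }
revert p Hp; apply is_poly_elim.
- exists (fun _ => 0); rewrite sumn_zero, Rmult_0_r; split; intros;
    [apply (is_RInt_eq (fun _ => 0)); [intros; ring|]|]; apply is_RInt_zero.
- intros p q (J & H1 & H2) (J' & H1' & H2').
  exists (fun ph => J ph + J' ph); split.
  + intros ph. apply (is_RInt_eq (fun th => p (sph th ph) * sin th + q (sph th ph) * sin th));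
      [intros; simpl; ring|].
    apply (@is_RInt_plus R_NormedModule); trivial.
  + rewrite sumn_plus, Rmult_plus_distr_l.
    apply (@is_RInt_plus R_NormedModule); trivial.
- intros r a b c Habc.
  exists (fun ph => r * (sincos (a + b + 1) c 0 PI * (sin ph ^ b * cos ph ^ a))); split.
  + intros ph.
    replace (r * (sincos (a + b + 1) c 0 PI * (sin ph ^ b * cos ph ^ a))) with
      ((r * (sin ph ^ b * cos ph ^ a)) * sincos (a + b + 1) c 0 PI) by ring.
    apply (is_RInt_eq (fun th => (r * (sin ph ^ b * cos ph ^ a)) *
      (sin th ^ (a + b + 1) * cos th ^ c))).
    * intros; unfold mono, sph; cbn [v1 v2 v3].
      rewrite !Rpow_mult_distr, !pow_add; simpl; ring.
    * apply (@is_RInt_scal R_NormedModule), is_RInt_sincos.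
  + rewrite sumn_scal.
    replace (4 * PI * / INR N * (r * sumn N (fun k => mono a b c (X k)))) with
      (r / INR N * (4 * PI * sumn N (fun k => mono a b c (X k)))) by (field; lra).
    rewrite Hmom by assumption. unfold sphere_moment.
    replace (r / INR N * (INR N * (sincos (a + b + 1) c 0 PI * sincos b a 0 (2 * PI))))
      with (r * (sincos (a + b + 1) c 0 PI * sincos b a 0 (2 * PI))) by (field; lra).
    do 2 apply (@is_RInt_scal R_NormedModule); apply is_RInt_sincos.
Qed.

Theorem theorem2 (t N : nat) (X : nat -> V3) (Y : nat -> V3 -> R) :
  (2 <= t)%nat ->
  ((t + 2) * (t + 2) <= N)%nat ->
  (forall i, (i < N)%nat -> on_sphere (X i)) ->
  (forall i k, (i < N)%nat -> (k < N)%nat -> X i = X k -> i = k) ->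
  stationary N t X ->
  orthonormal_basis (t + 1) Y ->
  (exists sigma, min_singular_value ((t + 2) * (t + 2)) N (basis_matrix Y X) sigma
                 /\ 0 < sigma) ->
  spherical_design N t X.
Proof.
intros _ HN HX _ Hst (_ & _ & Hspan) (sigma & Hmin & Hsig).
replace (t + 2)%nat with (t + 1 + 1)%nat in Hmin by lia.
(* Full rank in degree t+1 spreads the vanishing of the tangent field from the samples to the whole
   sphere. *)
assert (Htan : forall c x, on_sphere x ->
  sumn N (fun k => dot (spin c x) (X k) * dkernel t (dot x (X k))) = 0).
{ intros c x Hx. apply sum_tangent_spin; intros c' Hc'.
  apply (poly_eq0_of_sample (t + 1) N X Y sigma (fun x => sumn N (fun k =>
    dkernel t (dot x (X k)) * (coord c' (X k) - dot x (X k) * coord c' x))));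
    try assumption.
  - apply is_poly_tangent.
  - intros i Hi; now apply stationary_tangent. }
assert (Hleg : forall m, (m < t)%nat -> forall x, on_sphere x ->
  sumn N (fun k => legendre (S m) (dot x (X k))) = 0).
(* The coefficients are eigenvalues times kernel coefficients, nonzero because the degrees start at
   1. *)
{ apply (sum_legendre_eq0 N X t
    (fun m => - (INR (S m) * (INR (S m) + 1)) * kernel_coef m) HX).
  - intros m _. pose proof (kernel_coef_pos m). pose proof (pos_INR m).
    apply Rmult_integral_contrapositive_currified; [rewrite S_INR; nra|lra].
  - intros x Hx.
    rewrite <- (sum_beltrami_eq0_of_tangent N X (dkernel t)
      (fun u => sumn t (fun m => kernel_coef m * ddlegendre (S m) u)) HX
      (is_derive_dlegendre_sum t kernel_coef) Htan x Hx).
    apply sumn_ext; intros; symmetry; apply beltrami_legendre_sum. }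
apply design_of_moments; [lia|].
apply sum_mono_moment; [assumption|].
apply sum_pow_const; intros n Hn.
destruct n as [|n]; [lia|]. apply Hleg; lia.
Qed.
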